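(* Let $A$ be an Abelian group, let $G=(V,E)$ be a finite weakly connected directed graph (loops and multiple edges allowed), and let $G'$ be its underlying undirected graph. Let $\mathcal{WF}(V\cup\mathbb{E},A)$ be the group of balanced functions on the vertices and edges of $G$ in the flexible case. Then: 1. If $G'$ is bipartite, then the group $\mathcal{WF}(V\cup\mathbb{E},A)$ is isomorphic to $A^{|V|}$. 2. If $G'$ is not bipartite, then the group $\mathcal{WF}(V\cup\mathbb{E},A)$ is isomorphic to $A_2\times A^{|V|-1}$, where $A_2=\{a\in A : 2a=0\}$.
   Context: The Abelian group $A$ is written additively with identity $0$. A directed graph $G=(V,E)$ has a nonempty vertex set $V$ and a set $E$ of directed edges, each with an origin and an endpoint in $V$; loops and multiple edges are allowed. It is weakly connected if its underlying undirected graph is connected. An undirected graph with a loop is not bipartite. Flexible case. For each $e\in E$ from $v$ to $w$, let $\bar e$ denote the same edge taken in the opposite direction, going from $w$ to $v$; $\bar e$ is regarded as an element different from $e$ (also when $e$ is a loop), and $\bar{\bar e}=e$. Let $\mathbb{E}=\{e,\bar e : e\in E\}$. A path from a vertex $x$ to a vertex $y$ is an alternating sequence $v_1,e_1,v_2,e_2,\dots,v_n,e_n$ of vertices from $V$ and pairwise different edges from $\mathbb{E}$ such that $v_1=x$, each $e_j$ for $j=1,\dots,n-1$ goes from $v_j$ to $v_{j+1}$, and $e_n$ goes from $v_n$ to $y$. Vertices may repeat, and $e$ and $\bar e$ may both appear, since they are different elements of $\mathbb{E}$. A cycle is a path from a vertex to itself (the empty sequence is also permitted, as the trivial cycle). A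 function $h:V\cup\mathbb{E}\to A$ is called balanced if $h(\bar e)=-h(e)$ for all $e\in\mathbb{E}$ and $h(v_1)+h(e_1)+h(v_2)+h(e_2)+\dots+h(v_n)+h(e_n)=0$ for every cycle $v_1,e_1,\dots,v_n,e_n$ of $G$. The set $\mathcal{WF}(V\cup\mathbb{E},A)$ of all balanced functions $h:V\cup\mathbb{E}\to A$ is a group under pointwise addition. *)

(* Defs.v *)
From HB Require Import structures.
From mathcomp Require Import all_boot all_algebra.
From mathcomp Require Import boolp.

Set Implicit Arguments.
Unset Strict Implicit.
Unset Printing Implicit Defensive.

Import GRing.Theory.
Local Open Scope ring_scope.

(* Loops and multiple edges are allowed: [origin] and [endpoint] are arbitrary. *)
Record finDigraph := FinDigraph {
  vertex : finType;
  edge : finType;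
  origin : edge -> vertex;
  endpoint : edge -> vertex;
  vertex_gt0 : (0 < #|vertex|)%N
}.

Section Graph.
Variable G : finDigraph.

(* Adjacency in the underlying undirected graph; [x] has a loop iff
   [underlying x x]. *)
Definition underlying : rel (vertex G) :=
  fun x y => [exists e : edge G,
    ((origin e == x) && (endpoint e == y)) ||
    ((origin e == y) && (endpoint e == x))].

Definition weakly_connected : Prop :=
  forall x y : vertex G, connect underlying x y.

(* The two sides of the bipartition are [S] and its complement. *)
Definition underlying_bipartite : Prop :=
  exists S : {set vertex G},
    forall x y, underlying x y -> (x \in S) != (y \in S).

(* [(e, false)] is the edge e itself and [(e, true)] is e taken in the
   opposite direction. *)
Definition dart : finType := (edge G * bool)%type.

Definition bar (d : dart) : dart := (d.1, ~~ d.2).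

Definition dart_from (d : dart) : vertex G :=
  if d.2 then endpoint d.1 else origin d.1.

Definition dart_to (d : dart) : vertex G :=
  if d.2 then origin d.1 else endpoint d.1.

(* The sequence v_1, e_1, ..., v_n, e_n is encoded as the list of the pairs
   (v_j, e_j). *)
Fixpoint is_walk (x y : vertex G) (p : seq (vertex G * dart)) : bool :=
  if p is (v, e) :: p' then
    [&& v == x, dart_from e == v & is_walk (dart_to e) y p']
  else x == y.

Definition is_path (x y : vertex G) (p : seq (vertex G * dart)) : bool :=
  is_walk x y p && uniq [seq s.2 | s <- p].

Definition is_cycle (p : seq (vertex G * dart)) : Prop :=
  exists x, is_path x x p.

Section Balanced.
Variable A : zmodType.

Definition balanced (h : {ffun vertex G + dart -> A}) : Prop :=
  (forall d : dart, h (inr (bar d)) = - h (inr d)) /\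
  (forall p, is_cycle p -> \sum_(s <- p) (h (inl s.1) + h (inr s.2)) = 0).

Definition balanced_pred : {pred {ffun vertex G + dart -> A}} :=
  fun h => `[< balanced h >].

Fact balanced_zmod_closed : zmod_closed balanced_pred.
Proof.
split=> [|g h /asboolP[gN g0] /asboolP[hN h0]]; apply/asboolP; split.
- by move=> d; rewrite !ffunE oppr0.
- by move=> p _; apply: big1 => s _; rewrite !ffunE addr0.
- by move=> d; rewrite !ffunE gN hN opprD.
- move=> p pc; rewrite (eq_bigr (fun s => (g (inl s.1) + g (inr s.2)) -
      (h (inl s.1) + h (inr s.2)))) => [|s _].
    by rewrite sumrB g0 // h0 // subr0.
  by rewrite !ffunE opprD addrACA.
Qed.

HB.instance Definition _ :=
  GRing.isZmodClosed.Build _ balanced_pred balanced_zmod_closed.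

Record WF := MkWF {
  WF_fun :> {ffun vertex G + dart -> A};
  WF_funP : WF_fun \in balanced_pred
}.

HB.instance Definition _ := [isSub for WF_fun].
HB.instance Definition _ := [Choice of WF by <:].
HB.instance Definition _ := [SubChoice_isSubZmodule of WF by <:].

End Balanced.
End Graph.

Section TwoTorsion.
Variable A : zmodType.

Definition two_torsion_pred : {pred A} := fun a => a *+ 2 == 0.

Fact two_torsion_zmod_closed : zmod_closed two_torsion_pred.
Proof.
split=> [|a b /eqP a0 /eqP b0]; rewrite unfold_in ?mul0rn //.
by rewrite mulrnBl a0 b0 subr0.
Qed.

HB.instance Definition _ :=
  GRing.isZmodClosed.Build A two_torsion_pred two_torsion_zmod_closed.

Record two_torsion := MkTwoTorsion {
  two_torsion_val :> A;
  two_torsion_valP : two_torsion_val \in two_torsion_pred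
}.

HB.instance Definition _ := [isSub for two_torsion_val].
HB.instance Definition _ := [Choice of two_torsion by <:].
HB.instance Definition _ := [SubChoice_isSubZmodule of two_torsion by <:].

End TwoTorsion.

Definition zmod_isomorphic (U V : zmodType) : Prop :=
  exists f : {additive U -> V}, bijective f.

(* Main.v *)
Require Import Defs.
From HB Require Import structures.
From mathcomp Require Import all_boot all_algebra.
From mathcomp Require Import boolp.

Set Implicit Arguments.
Unset Strict Implicit.
Unset Printing Implicit Defensive.

Import GRing.Theory.
Local Open Scope ring_scope.

(** A dart followed by its reverse is a cycle, on which the two edge values of a
    balanced function [h] cancel; hence [h (inl w) = - h (inl v)] for the ends
    [v], [w] of every edge, and [h] alternates on the vertices.  The step weight
    [h (inl v) + h (inr d)] of a dart [d] leaving [v] has zero sum along every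
    cycle, hence along every closed walk ([closed_walk_sum0]), so it is the
    increment of a potential [p], unique once [p] vanishes at a chosen root.
    Conversely an alternating function [a] on the vertices and a potential [p]
    determine the balanced function with
    [h (inl v) = a v] and [h (inr d) = p w - p v - a v]: its sum along a cycle
    telescopes, and alternation of [a] is exactly what makes it odd under
    reversal.  Balanced functions are therefore pairs of an alternating
    function and a potential vanishing at the root
    ([WF_isomorphic_alternating_potential]).

    The potentials contribute one copy of [A] for each vertex other than the
    root.  As the graph is connected, an alternating function is determined by
    its value [a0] at the root, with values [a0] and [- a0].  On a bipartite
    graph any [a0] is possible, and it can fill the free place at the root.
    Otherwise [2 a0 = 0], since the level set of [a0] would be one side of a
    bipartition if [a0] and [- a0] were different
    ([alternating_nonbipartite]). *)

(** * Isomorphisms of abelian groups *)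

(** Inverting the parametrization instead of the map to be found leaves only
    injectivity and surjectivity to check, with no formula for the inverse. *)
Lemma zmod_isomorphic_inj_surj (U V : zmodType) (f : U -> V) :
  zmod_morphism f -> injective f -> (forall v, exists u, f u = v) ->
  zmod_isomorphic V U.
Proof.
move=> fB f_inj f_surj.
have fP v : exists u, f u == v by have [u <-] := f_surj v; exists u.
pose g v := xchoose (fP v).
have gK : cancel g f by move=> v; apply/eqP/(xchooseP (fP v)).
have gB : zmod_morphism g by move=> v w; apply: f_inj; rewrite fB !gK.
pose gM := GRing.isZmodMorphism.Build V U g gB.
pose G : {additive V -> U} := HB.pack g gM.
by exists G, f => // u; apply: f_inj; rewrite gK.
Qed.

(** * Walks and potentials *)

Lemma not_uniq_split (T : eqType) (s : seq T) : ~~ uniq s ->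
  exists x s1 s2 s3, s = s1 ++ x :: s2 ++ x :: s3.
Proof.
elim: s => //= a s IHs; rewrite negb_and negbK => /orP[|/IHs].
  by case/splitPr=> s2 s3; exists a, [::], s2, s3.
by case=> x [s1 [s2 [s3 ->]]]; exists x, (a :: s1), s2, s3.
Qed.

Section Walks.
Variable G : finDigraph.
Implicit Types (x y z : vertex G) (p q : seq (vertex G * dart G)).

Lemma is_walk_cat x y p q :
  is_walk x y (p ++ q) <-> exists2 z, is_walk x z p & is_walk z y q.
Proof.
elim: p x => [|[v d] p IHp] x /=.
  by split=> [|[z /eqP->]//]; exists x.
split=> [/and3P[-> -> /IHp[z pz qz]]|[z /and3P[-> -> pz] qz]]; first by exists z.
by apply/IHp; exists z.
Qed.

Lemma is_walk_from x y p s : is_walk x y p -> s \in p -> s.1 = dart_from s.2.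
Proof.
elim: p x => //= [[v d] p IHp] x /and3P[_ /eqP dv /IHp IH].
by rewrite inE => /orP[/eqP->|/IH].
Qed.

Lemma underlyingP x y :
  reflect (exists2 d, dart_from d = x & dart_to d = y) (underlying x y).
Proof.
apply: (iffP existsP) => [[e /orP[]/andP[/eqP<- /eqP<-]]|[[e []] /= <- <-]].
- by exists (e, false).
- by exists (e, true).
- by exists e; rewrite !eqxx orbT.
- by exists e; rewrite !eqxx.
Qed.

Lemma connect_walk x y : connect (@underlying G) x y -> exists p, is_walk x y p.
Proof.
case/connectP=> s + ->; elim: s x => [|z s IHs] x /=; first by exists [::] => /=.
case/andP=> /underlyingP[d <- <-] /IHs[p wp].
by exists ((dart_from d, d) :: p); rewrite /= !eqxx.
Qed.

(** A closed walk using a dart twice splits, at the two occurrences of that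
    dart, into two shorter closed walks, so it is a sum of cycles. *)
Lemma closed_walk_sum0 (A : zmodType) (f : vertex G * dart G -> A) :
  (forall p, is_cycle p -> \sum_(s <- p) f s = 0) ->
  forall x p, is_walk x x p -> \sum_(s <- p) f s = 0.
Proof.
move=> f0 x p; have [n] := ubnP (size p); elim: n => // n IHn in x p *.
rewrite ltnS => p_n wp; have [p_uniq|/not_uniq_split] := boolP (uniq p).
  apply: f0; exists x; rewrite /is_path wp map_inj_in_uniq // => s t ps pt st.
  by rewrite [s]surjective_pairing [t]surjective_pairing
             (is_walk_from wp ps) (is_walk_from wp pt) st.
case=> -[v d] [p1 [p2 [p3 Dp]]]; move: p_n wp; rewrite {p}Dp => p_n.
case/is_walk_cat=> z wp1 /= /and3P[/eqP vz dv /is_walk_cat[z' wp2]].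
case/and3P=> /eqP vz' _ wp3; subst z z'.
rewrite size_cat /= size_cat /= !addnS addnA in p_n.
have loop0 : \sum_(s <- (v, d) :: p2) f s = 0.
  apply: (IHn v) => /=; last by rewrite eqxx dv.
  by apply: leq_trans p_n; rewrite !ltnS -addnA addnCA leq_addr.
have rest0 : \sum_(s <- p1 ++ (v, d) :: p3) f s = 0.
  apply: (IHn x).
    apply: leq_trans p_n.
    by rewrite size_cat /= addnS !ltnS leq_add2r leq_addr.
  by apply/is_walk_cat; exists v; rewrite //= eqxx dv.
by rewrite big_cat -cat_cons big_cat /= loop0 add0r -big_cat.
Qed.

(** The potential at [y] is the sum along any walk from the root to [y]; two
    such walks have the same sum because a common walk back closes both. *)
Lemma walk_potential (A : zmodType) (f : vertex G * dart G -> A) x0 :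
    weakly_connected G ->
    (forall x p, is_walk x x p -> \sum_(s <- p) f s = 0) ->
  exists2 g : {ffun vertex G -> A}, g x0 = 0 &
    forall d, f (dart_from d, d) = g (dart_to d) - g (dart_from d).
Proof.
move=> Gconn f0.
pose walk_to y := xchoose (connect_walk (Gconn x0 y)).
have walk_toP y : is_walk x0 y (walk_to y) by apply: xchooseP.
have sumE y p : is_walk x0 y p -> \sum_(s <- p) f s = \sum_(s <- walk_to y) f s.
  move=> wp; have [q wq] := connect_walk (Gconn y x0).
  apply: (addIr (\sum_(s <- q) f s)); rewrite -!big_cat /=.
  by rewrite !(f0 x0) //; apply/is_walk_cat; exists y.
exists [ffun y => \sum_(s <- walk_to y) f s] => [|d]; rewrite !ffunE.
  by rewrite (f0 x0).
rewrite -(sumE _ (walk_to (dart_from d) ++ [:: (dart_from d, d)])).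
  by rewrite big_cat big_seq1 addrC addKr.
by apply/is_walk_cat; exists (dart_from d); rewrite //= !eqxx.
Qed.

Lemma weakly_connected_const (T : Type) (f : vertex G -> T) :
    weakly_connected G ->
    (forall e : edge G, f (endpoint e) = f (origin e)) ->
  forall x y, f x = f y.
Proof.
move=> Gconn fE x y; have /connectP[s + ->] := Gconn x y.
elim: s x => //= z s IHs x /andP[/underlyingP[d <- <-] /IHs<-].
by case: d => e [] /=; rewrite fE.
Qed.

End Walks.

(** * Balanced functions from alternating functions and potentials *)

Section Alternating.
Variables (G : finDigraph) (A : zmodType).
Implicit Types (a p : {ffun vertex G -> A}) (h : {ffun vertex G + dart G -> A}).

Definition alternating a := forall e, a (endpoint e) = - a (origin e).

Definition of_potential a p : {ffun vertex G + dart G -> A} :=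
  [ffun z => match z with
             | inl x => a x
             | inr d => p (dart_to d) - p (dart_from d) - a (dart_from d)
             end].

Lemma of_potential_balanced a p : alternating a -> balanced (of_potential a p).
Proof.
move=> aN; split=> [[e b]|s [x /andP[ws _]]].
  by rewrite !ffunE; case: b; rewrite /= aN; rewrite !opprD !opprK (addrC (p _)).
suffices sumE y z : is_walk y z s -> \sum_(t <- s)
    (of_potential a p (inl t.1) + of_potential a p (inr t.2)) = p z - p y.
  by rewrite (sumE x x) ?subrr.
elim: s y {ws} => [|[v d] s IHs] y /=.
  by move/eqP->; rewrite big_nil subrr.
case/and3P=> /eqP<- /eqP dv /IHs; rewrite big_cons => ->.
by rewrite !ffunE /= dv (addrC (a _)) subrK addrC addrA subrK.
Qed.

(** The two darts of an edge from [v] to [w] form a cycle, of sum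
    [h (inl v) + h (inl w)]; they are different even for a loop. *)
Lemma balanced_alternating h :
  balanced h -> alternating [ffun x => h (inl x)].
Proof.
case=> hN h0 e; rewrite !ffunE; apply/eqP; rewrite -addr_eq0.
rewrite -(h0 [:: (origin e, (e, false)); (endpoint e, (e, true))]); last first.
  by exists (origin e); rewrite /is_path /= !eqxx !inE xpair_eqE andbF.
rewrite !big_cons big_nil /= addr0 (hN (e, false)) addrACA subrr addr0.
by rewrite addrC.
Qed.

Lemma balanced_of_potential h x0 : weakly_connected G -> balanced h ->
  exists a p, [/\ alternating a, p x0 = 0 & h = of_potential a p].
Proof.
move=> Gconn hb; have [_ h0] := hb.
have [p px0 pE] := @walk_potential _ _ _ x0 Gconn (closed_walk_sum0 h0).
exists [ffun x => h (inl x)], p; split=> //; first exact: balanced_alternating.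
by apply/ffunP=> -[x|d]; rewrite !ffunE // -pE /= addrC addKr.
Qed.

(** The group [U] stands for the pairs of an alternating function [u t] and a
    potential [p t] vanishing at [x0].  Injectivity is where the normalization
    counts: potentials with the same increments differ by a constant, which
    connectedness and the value at [x0] force to be [0]. *)
Lemma WF_isomorphic_alternating_potential (U : zmodType) x0
    (u p : U -> {ffun vertex G -> A}) :
    weakly_connected G -> zmod_morphism u -> zmod_morphism p ->
    (forall t, alternating (u t)) -> (forall t, p t x0 = 0) ->
    (forall t t', u t = u t' -> p t = p t' -> t = t') ->
    (forall a (q : {ffun vertex G -> A}), alternating a -> q x0 = 0 ->
      exists2 t, u t = a & p t = q) ->
  zmod_isomorphic (WF G A) U.
Proof.
move=> Gconn uB pB uN px0 up_inj up_surj.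
have FP t : of_potential (u t) (p t) \in @balanced_pred G A.
  by apply/asboolP/of_potential_balanced.
apply: (@zmod_isomorphic_inj_surj U _ (fun t => MkWF (FP t))).
- move=> t t'; apply: val_inj; rewrite raddfB; apply/ffunP=> -[x|d].
    by rewrite !ffunE uB !ffunE.
  rewrite !ffunE /= uB pB !ffunE !opprD !opprK.
  by rewrite [RHS]addrACA; congr (_ + _); rewrite addrACA.
- move=> t t' /(congr1 val) /= /ffunP E.
  have uE : u t = u t' by apply/ffunP=> x; have:= E (inl x); rewrite !ffunE.
  apply: up_inj => //; apply/ffunP=> x.
  have dE (e : edge G) :
      p t (endpoint e) - p t' (endpoint e) = p t (origin e) - p t' (origin e).
    have:= E (inr (e, false)); rewrite !ffunE uE => /addIr/eqP /=.
    rewrite subr_eq => /eqP->.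
    by rewrite addrAC [X in X + _]addrAC subrr add0r addrC.
  apply: subr0_eq.
  rewrite (weakly_connected_const (f := fun y => p t y - p t' y) Gconn dE x x0).
  by rewrite !px0 subrr.
- move=> [h hP]; have /asboolP hb := hP.
  have [a [q [aN qx0 Dh]]] := balanced_of_potential x0 Gconn hb.
  have [t ta tq] := up_surj a q aN qx0; exists t; apply: val_inj => /=.
  by rewrite ta tq.
Qed.

(** * Alternating functions on bipartite and other graphs *)

Definition signed (S : {set vertex G}) (a : A) : {ffun vertex G -> A} :=
  [ffun x => if x \in S then - a else a].

Lemma signed_alternating (S : {set vertex G}) b :
    (forall x y, underlying x y -> (x \in S) != (y \in S)) ->
  alternating (signed S b).
Proof.
move=> Sbip e; have/Sbip : underlying (origin e) (endpoint e).
  by apply/underlyingP; exists (e, false).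
by rewrite !ffunE; do 2!case: (_ \in S); rewrite ?opprK.
Qed.

(** The root may lie on either side of the bipartition, and the inner [signed]
    corrects the sign of [a x0] accordingly: [signed S] is an involution at
    each vertex. *)
Lemma alternating_bipartite (S : {set vertex G}) a x0 :
    weakly_connected G ->
    (forall x y, underlying x y -> (x \in S) != (y \in S)) ->
  alternating a -> a = signed S (signed S (a x0) x0).
Proof.
move=> Gconn Sbip aN; apply/ffunP=> x; rewrite !ffunE.
suffices : (if x \in S then - a x else a x) =
    (if x0 \in S then - a x0 else a x0).
  by move=> <-; case: (x \in S); rewrite ?opprK.
apply: (@weakly_connected_const _ _ (fun x => if x \in S then - a x else a x)
          Gconn) => e.
have /Sbip : underlying (origin e) (endpoint e).
  by apply/underlyingP; exists (e, false).
by rewrite aN; do 2!case: (_ \in S); rewrite ?opprK.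
Qed.

(** An alternating function has values [a x0] and [- a x0] only; were they
    different, they would colour the graph properly. *)
Lemma alternating_nonbipartite a x0 :
    weakly_connected G -> ~ underlying_bipartite G -> alternating a ->
  a x0 *+ 2 = 0 /\ forall x, a x = a x0.
Proof.
move=> Gconn Gnbip aN.
have aNd d : a (dart_to d) = - a (dart_from d).
  by case: d => e [] /=; rewrite aN ?opprK.
have a_pm x : (a x == a x0) || (a x == - a x0).
  rewrite (@weakly_connected_const _ _
    (fun x => (a x == a x0) || (a x == - a x0)) Gconn _ x x0) ?eqxx // => e.
  by rewrite aN eqr_opp eqr_oppLR orbC.
have a2 : a x0 *+ 2 = 0.
  apply/eqP; apply: contrapT => /negP a2; apply: Gnbip.
  exists [set x | a x == a x0] => _ _ /underlyingP[d <- <-]; rewrite !inE aNd.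
  have a0N : (- a x0 == a x0) = false.
    by rewrite eq_sym -addr_eq0 -mulr2n (negbTE a2).
  by have /orP[/eqP->|/eqP->] := a_pm (dart_from d); rewrite ?opprK eqxx a0N.
split=> // x; have /orP[/eqP->|/eqP->] // := a_pm x.
by apply/esym/eqP; rewrite -addr_eq0 -mulr2n a2.
Qed.

End Alternating.

(** * The group of balanced functions *)

Unset Implicit Arguments.
Set Strict Implicit.

Theorem theorem2p15 (A : zmodType) (G : finDigraph)
    (Gconn : weakly_connected G) :
  (underlying_bipartite G ->
     zmod_isomorphic (WF G A) {ffun 'I_#|vertex G| -> A}) /\
  (~ underlying_bipartite G ->
     zmod_isomorphic (WF G A)
       (two_torsion A * {ffun 'I_(#|vertex G| - 1) -> A})%type).
Proof.
have [x0 _] : exists x0 : vertex G, x0 \in vertex G.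
  by apply/card_gt0P/vertex_gt0.
split=> [[S Sbip]|Gnbip].
  (* The potential leaves the entry of [t] at [x0] free; the alternating
     function is scaled by it. *)
  apply: (@WF_isomorphic_alternating_potential G A {ffun _ -> A} x0
            (fun t => signed S (t (enum_rank x0)))
            (fun t => [ffun x => if x == x0 then 0 else t (enum_rank x)])) => //.
  - by move=> t t'; apply/ffunP=> x; rewrite !ffunE; case: ifP; rewrite // opprD.
  - by move=> t t'; apply/ffunP=> x; rewrite !ffunE; case: ifP; rewrite // subrr.
  - by move=> t; apply: signed_alternating.
  - by move=> t; rewrite ffunE eqxx.
  - move=> t t' /ffunP uE /ffunP pE; apply/ffunP=> i; rewrite -(enum_valK i).
    have [->|ix0] := eqVneq (enum_val i) x0.
      by have:= uE x0; rewrite !ffunE; case: ifP => // _ /oppr_inj.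
    by have:= pE (enum_val i); rewrite !ffunE (negbTE ix0).
  - move=> a q aN qx0.
    exists [ffun i => if enum_val i == x0 then signed S (a x0) x0
                      else q (enum_val i)].
      by rewrite ffunE enum_rankK eqxx -alternating_bipartite.
    by apply/ffunP=> x; rewrite !ffunE enum_rankK; case: eqP => // ->.
(* [unlift i0] numbers the vertices other than [x0]. *)
rewrite subn1; set i0 := enum_rank x0.
apply: (@WF_isomorphic_alternating_potential G A
          (two_torsion A * {ffun _ -> A})%type x0
          (fun t => [ffun=> val t.1])
          (fun t => [ffun x => if unlift i0 (enum_rank x) is Some j
                               then t.2 j else 0])) => //.
- by move=> t t'; apply/ffunP=> x; rewrite !ffunE.
- move=> t t'; apply/ffunP=> x; rewrite !ffunE.
  by case: unlift => [j|]; rewrite ?ffunE ?subrr.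
- move=> t e; rewrite !ffunE; apply/eqP.
  by rewrite -addr_eq0 -mulr2n; apply: (valP t.1).
- by move=> t; rewrite ffunE unlift_none.
- move=> [b t] [b' t'] /ffunP/(_ x0); rewrite !ffunE /= => /val_inj-> /ffunP pE.
  congr (_, _); apply/ffunP=> j; have:= pE (enum_val (lift i0 j)).
  by rewrite !ffunE enum_valK liftK.
- move=> a q aN qx0; have [a2 aC] := alternating_nonbipartite x0 Gconn Gnbip aN.
  have a2P : a x0 \in @two_torsion_pred A by rewrite unfold_in a2.
  exists (MkTwoTorsion a2P, [ffun j => q (enum_val (lift i0 j))]).
    by apply/ffunP=> x; rewrite ffunE aC.
  apply/ffunP=> x; rewrite !ffunE; case: unliftP => [j Dx|/enum_rank_inj->//].
  by rewrite ffunE -Dx enum_rankK.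
Qed.
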